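(* Let $f_t\in\mathbb{C}_1[[z]]$ for $t\in(a,b)$ have coefficients which are differentiable in $t$. (1) There is an $h_t\in\mathbb{C}_{\geq1}[[z]]$ (for $t \in (a,b)$) such that $$\frac{\partial f_t}{\partial t}(z)=h_t(z)f_t'(z).$$ The $n$th coefficient of $h_t$ depends only on the first $n$ coefficients of $f_t$ and $\partial f_t/\partial t$. (2) There is an $\tilde h_t\in\mathbb{C}_{\geq1}[[z]]$ such that $$\frac{\partial f_t}{\partial t}(z)=\tilde h_t\circ f_t(z).$$ The $n$th coefficient of $\tilde h_t$ depends only on the first $n$ coefficients of $f_t$ and $\partial f_t/\partial t$. Similarly, if $f_t\in\mathbb{C}_1[[1/z]]$, $t\in(a,b)$, has differentiable coefficients, one can find $h_t,\tilde h_t\in\mathbb{C}_{\leq1}[[1/z]]$ such that $\frac{\partial f_t}{\partial t}=h_tf_t'$ and $\frac{\partial f_t}{\partial t}=\tilde h_t\circ f_t$.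
   Context: $\mathbb{C}_1[[z]]$ is the set of formal power series $\sum_{n\geq 1}a_nz^n$ with $a_n\in\mathbb{C}$, $a_1\neq 0$; $\mathbb{C}_1[[1/z]]$ is the set of formal series $\sum_{n\le 1}a_nz^n$ with $a_1\ne 0$. $\mathbb{C}_{\geq 1}[[z]]$ is the vector space of all formal series $\sum_{n\geq 1}h_nz^n$, and $\mathbb{C}_{\leq 1}[[1/z]]$ is the vector space of all formal series $\sum_{n\le 1}h_nz^n$ ($0$ included in both). $\partial f_t/\partial t$ is the series obtained by differentiating each coefficient in $t$, $f_t'$ is the formal derivative in $z$, and composition is formal composition (only finite sums are involved). *)

(* Defs.v *)
From HB Require Import structures.
From mathcomp Require Import all_boot all_order all_algebra.
From mathcomp Require Import all_classical all_reals all_analysis.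
From mathcomp Require Import complex.

Set Implicit Arguments.
Unset Strict Implicit.
Unset Printing Implicit Defensive.

Import Order.TTheory GRing.Theory Num.Theory.
Import numFieldNormedType.Exports.
Local Open Scope classical_set_scope.
Local Open Scope ring_scope.

(* [a : fseries R] stands for the two-sided formal series
   \sum_(n : int) (a n) z^n; the spaces of one-sided series are cut out by the
   support predicates below. *)
Definition fseries (R : realType) : Type := int -> R[i].

Section FormalSeries.
Variable R : realType.
Implicit Types (a b f h : fseries R) (n k : int).

(* C_{>=1}[[z]] *)
Definition Cge1 a : Prop := forall n, n < 1 -> a n = 0.

(* C_1[[z]] *)
Definition C1z a : Prop := Cge1 a /\ a 1 != 0.

(* C_{<=1}[[1/z]] *)
Definition Cle1 a : Prop := forall n, 1 < n -> a n = 0.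

(* C_1[[1/z]] *)
Definition C1zinv a : Prop := Cle1 a /\ a 1 != 0.

Definition fone : fseries R := fun n => (n == 0)%:R.

(* [\sum_(k \in A)] is the sum over the finite support (and 0 if the support is
   infinite). The support is finite when both factors are series in z, or both
   are series in 1/z, with finitely many terms of the other sign. *)
Definition fmul a b : fseries R :=
  fun n => \sum_(k \in [set: int]) (a k * b (n - k)).

Definition fexp a (m : nat) : fseries R := iter m (fmul a) fone.

Definition fderiv a : fseries R := fun n => (n + 1)%:~R * a (n + 1).

(* For f in C_1[[z]] or C_1[[1/z]], write f = a_1 z (1 - u) with a_1 = f 1;
   then 1/f = (a_1 z)^-1 \sum_(j >= 0) u^j. Each coefficient is a finite
   sum, as u involves only z, z^2, ... (resp. only 1/z, 1/z^2, ...). *)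
Definition fgap f : fseries R := fun n => (n == 0)%:R - (f 1)^-1 * f (n + 1).

Definition fseries_inv f : fseries R :=
  fun n => (f 1)^-1 * \sum_(j \in [set: nat]) fexp (fgap f) j (n + 1).

Definition fexpz f k : fseries R :=
  match k with
  | Posz m => fexp f m
  | Negz m => fexp (fseries_inv f) m.+1
  end.

(* h o f = \sum_k h_k f^k. Negative powers of f only matter for series in 1/z;
   for h in C_{>=1}[[z]] their coefficients h_k vanish. *)
Definition fcomp h f : fseries R :=
  fun n => \sum_(k \in [set: int]) (h k * fexpz f k n).

(* Functions of a real variable with values in R[i] are differentiated through
   their real and imaginary parts, R[i] being no normed space over R in the
   library. *)
Definition cderivable (g : R -> R[i]) (t : R) : Prop :=
  derivable (fun s => complex.Re (g s)) t 1 /\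
  derivable (fun s => complex.Im (g s)) t 1.

Definition cderive1 (g : R -> R[i]) (t : R) : R[i] :=
  (derive1 (fun s => complex.Re (g s)) t
     +i* derive1 (fun s => complex.Im (g s)) t)%C.

Definition fdt (f : R -> fseries R) (t : R) : fseries R :=
  fun n => cderive1 (fun s => f s n) t.

Definition first_coefs (n : nat) a : n.-tuple R[i] :=
  [tuple a (i.+1)%:Z | i < n].

End FormalSeries.

(* The bounds of the interval may be infinite. *)
Definition in_oo (R : realType) (a b : \bar R) (t : R) : Prop :=
  (a < t%:E < b)%E.

(* Main.v *)
(** Comparing coefficients, each equation reads
    [g_n = \sum_k h_k A_(k, n)] with [g] the time derivative of [f], where
    [A_(k, n)] is the coefficient of z^(n-k) in f' for the product and of z^n
    in f^k for the composition. Counting away from n = 1 (upwards for series in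
    z, downwards for series in 1/z), this system is triangular with diagonal
    f_1, resp. f_1^k, so it has a solution by forward substitution. For series
    in z, the entries used up to index n only involve f_1, ..., f_n. *)

Require Import Defs.
From HB Require Import structures.
From mathcomp Require Import all_boot all_order all_algebra.
From mathcomp Require Import all_classical all_reals all_analysis.
From mathcomp Require Import complex.
From mathcomp Require Import zify ring.
Import Order.TTheory GRing.Theory Num.Theory.
Import numFieldNormedType.Exports.
Local Open Scope ring_scope.

Set Implicit Arguments.
Unset Strict Implicit.
Unset Printing Implicit Defensive.

(** * Forward substitution for triangular systems *)

Section TriangularSystem.
Variable K : fieldType.
Implicit Types (B : nat -> nat -> K) (y : nat -> K).

(** Each unknown needs all the earlier ones, so the recursion carries the list of those already
    computed. *)
Fixpoint trisol_seq B y (m : nat) : seq K :=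
  if m is p.+1 then
    let xs := trisol_seq B y p in
    rcons xs ((y p - \sum_(j < p) xs`_j * B j p) / B p p)
  else [::].

Definition trisol B y (m : nat) : K := (trisol_seq B y m.+1)`_m.

Lemma size_trisol_seq B y m : size (trisol_seq B y m) = m.
Proof. by elim: m => //= m IH; rewrite size_rcons IH. Qed.

Lemma nth_trisol_seq B y m j : (j < m)%N -> (trisol_seq B y m)`_j = trisol B y j.
Proof.
elim: m => // m IH; rewrite ltnS leq_eqVlt => /predU1P[->//|jm] /=.
by rewrite nth_rcons size_trisol_seq jm IH.
Qed.

Lemma trisolE B y m :
  trisol B y m = (y m - \sum_(j < m) trisol B y j * B j m) / B m m.
Proof.
rewrite /trisol /= nth_rcons size_trisol_seq ltnn eqxx.
by under eq_bigr => j _ do rewrite nth_trisol_seq//.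
Qed.

Lemma trisolP B y m : B m m != 0 ->
  \sum_(j < m.+1) trisol B y j * B j m = y m.
Proof.
by move=> Bmm; rewrite big_ord_recr/= trisolE divfK// addrC subrK.
Qed.

(** Forward substitution never looks past column [m] or below the diagonal. This is the source of
    the dependence on finitely many coefficients. *)
Lemma eq_trisol B B' y y' m :
  (forall j k, (j <= k <= m)%N -> B j k = B' j k) ->
  (forall k, (k <= m)%N -> y k = y' k) ->
  trisol B y m = trisol B' y' m.
Proof.
elim/ltn_ind: m => m IH eB ey.
rewrite !trisolE ey// eB ?leqnn//; congr ((_ - _) / _).
apply: eq_bigr => j _; rewrite eB ?leqnn ?andbT 1?ltnW//.
rewrite (IH j)// => [i k /andP[ij kj]|k kj].
  by rewrite eB// ij/=; apply: leq_trans kj (ltnW _).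
by rewrite ey//; apply: leq_trans kj (ltnW _).
Qed.

End TriangularSystem.

(** * Leading terms of series in z and in 1/z *)

Section OrderedSeries.
Local Open Scope classical_set_scope.
Variables (R : realType) (s : int).
Hypothesis s_unit : s = 1 \/ s = -1.
Implicit Types (a b f g h : fseries R) (A : int -> int -> R[i]) (n d e k : int).

(* [s = 1] handles series in z and [s = -1] series in 1/z: [a] starts at
   z^d, its exponents going up for [s = 1] and down for [s = -1]. *)
Definition starts_at d a : Prop := forall n, s * n < s * d -> a n = 0.

Lemma starts_fmul d e a b :
  starts_at d a -> starts_at e b -> starts_at (d + e) (fmul a b).
Proof.
move=> sa sb n sn; apply: fsbig1 => k _.
have [kd|kd] := ltP (s * k) (s * d); first by rewrite sa ?mul0r.
by rewrite sb ?mulr0//; move: sn kd; case: s_unit => ->; lia.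
Qed.

Lemma fsum_only (I : choiceType) (i : I) (F : I -> R[i]) :
  (forall j, j != i -> F j = 0) -> \sum_(j \in [set: I]) F j = F i.
Proof.
move=> F0; transitivity (\sum_(j \in [set i]) F j); last exact: fsbig_set1.
by apply/esym/fsbig_widen => // j [_ /eqP]; exact: F0.
Qed.

(** Only [k = d] survives in the convolution: before [d] the factor from [a] vanishes, after [d] the
    one from [b] does. *)
Lemma fmul_start d e a b :
  starts_at d a -> starts_at e b -> fmul a b (d + e) = a d * b e.
Proof.
move=> sa sb; rewrite /fmul (fsum_only (i := d)) => [|k kd]; last first.
  have [kd'|kd'] := ltP (s * k) (s * d); first by rewrite sa ?mul0r.
  by rewrite sb ?mulr0//; move: kd kd'; case: s_unit => ->; lia.
by congr (_ * b _); ring.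
Qed.

Lemma starts_fexp d a (m : nat) :
  starts_at d a -> starts_at (d * m%:Z) (fexp a m).
Proof.
move=> sa; elim: m => [|m IH].
  by rewrite mulr0 => n sn; rewrite /fexp/= /fone; case: eqP sn => // ->; lia.
have -> : d * m.+1%:Z = d + d * m%:Z by rewrite -addn1 PoszD; ring.
exact: starts_fmul.
Qed.

Lemma fexp_start d a (m : nat) :
  starts_at d a -> fexp a m (d * m%:Z) = a d ^+ m.
Proof.
move=> sa; elim: m => [|m IH]; first by rewrite mulr0 /fexp/= /fone eqxx.
have -> : d * m.+1%:Z = d + d * m%:Z by rewrite -addn1 PoszD; ring.
rewrite exprS -IH; apply: fmul_start => //; exact: starts_fexp.
Qed.

(** * Integer powers of an invertible series *)

Section Invertible.
Variable f : fseries R.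
Hypotheses (sf : starts_at 1 f) (f1 : f 1 != 0).

(** Dividing by [f 1] cancels the constant term, so that the j-th power of the gap starts at
    exponent [s * j]. *)
Lemma starts_fgap : starts_at s (fgap f).
Proof.
move=> n sn; rewrite /fgap; have [->|n0] := eqVneq n 0.
  by rewrite add0r mulVf// subrr.
by rewrite (sf (n := n + 1)) ?mulr0 ?subr0//; move: sn n0; case: s_unit => ->; lia.
Qed.

(** The coefficient of z^n in 1/f reads the powers of the gap at [n + 1], and none of them starts
    before 0. *)
Lemma starts_fseries_inv : starts_at (-1) (fseries_inv f).
Proof.
move=> n sn; rewrite /fseries_inv fsbig1 ?mulr0// => j _.
apply: (starts_fexp starts_fgap).
by move: sn; case: s_unit => ->; nia.
Qed.

Lemma fseries_inv_start : fseries_inv f (-1) = (f 1)^-1.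
Proof.
(* At exponent -1 the powers of the gap are read at 0, where only the zeroth power contributes. *)
rewrite /fseries_inv (fsum_only (i := 0%N)) => [|j j0].
  by rewrite /fexp/= /fone mulr1.
apply: (starts_fexp starts_fgap).
by move: j0; case: s_unit => ->; nia.
Qed.

Lemma starts_fexpz k : starts_at k (fexpz f k).
Proof.
case: k => m; rewrite /fexpz.
  by have := starts_fexp (m := m) sf; rewrite mul1r.
by have := starts_fexp (m := m.+1) starts_fseries_inv; rewrite mulN1r -NegzE.
Qed.

Lemma fexpz_start_neq0 k : fexpz f k k != 0.
Proof.
case: k => m; rewrite /fexpz.
  by have := fexp_start m sf; rewrite mul1r => ->; rewrite expf_neq0.
have := fexp_start m.+1 starts_fseries_inv; rewrite mulN1r -NegzE => ->.
by rewrite fseries_inv_start expf_neq0// invr_eq0.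
Qed.

Lemma starts_fderiv : starts_at 0 (fderiv f).
Proof.
move=> k sk; rewrite /fderiv (sf (n := k + 1)) ?mulr0//.
by move: sk; case: s_unit => ->; lia.
Qed.

End Invertible.

(** Forward substitution after the change of index n = 1 + s k with k >= 0, so that k is the
    distance of n from 1. *)
Definition series_sol A g : fseries R := fun n =>
  if 0 <= s * (n - 1) then
    trisol (fun j k : nat => A (1 + s * j%:Z) (1 + s * k%:Z))
      (fun k : nat => g (1 + s * k%:Z)) `|n - 1|%N
  else 0.

Lemma starts_series_sol A g : starts_at 1 (series_sol A g).
Proof.
move=> n sn; rewrite /series_sol ifF//.
by apply/negbTE; move: sn; case: s_unit => ->; lia.
Qed.

Lemma series_solP A g :
  starts_at 1 g ->
  (forall k, starts_at k (A k)) -> (forall k, A k k != 0) ->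
  g = (fun n => \sum_(k \in [set: int]) (series_sol A g k * A k n)).
Proof.
move=> sg sA Akk; apply/funext => n.
have [n1|n1] := ltP (s * n) (s * 1).
  rewrite sg// fsbig1// => k _.
  have [k1|k1] := ltP (s * k) (s * 1); first by rewrite starts_series_sol ?mul0r.
  by rewrite sA ?mulr0//; apply: lt_le_trans k1.
have [m nE] : exists m : nat, n = 1 + s * m%:Z.
  by exists `|n - 1|%N; move: n1; case: s_unit => ->; lia.
(* The exponents from 1 to [n] in direction [s]; outside this list either the unknown or [A k n]
   vanishes, which leaves the finite sum of [trisolP]. *)
pose r := [seq 1 + s * (j : nat)%:Z | j <- iota 0 m.+1].
have ur : uniq r.
  rewrite map_inj_uniq ?iota_uniq// => i j.
  by case: s_unit => ->; lia.
transitivity (\sum_(k <- r) series_sol A g k * A k n); last first.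
  rewrite fsbig_seq//; apply: fsbig_widen => // k [_ /= kr].
  have [k1|k1] := ltP (s * k) (s * 1); first by rewrite starts_series_sol ?mul0r.
  rewrite sA ?mulr0// ltNge; apply/negP => kn; apply: kr.
  apply/mapP; exists `|k - 1|%N; last by move: k1; case: s_unit => ->; lia.
  by rewrite mem_iota; move: k1 kn; rewrite nE; case: s_unit => ->; lia.
rewrite big_map -[iota _ _]/(index_iota 0 m.+1) big_mkord nE.
rewrite -[LHS](trisolP (B := fun j k : nat => A (1 + s * j%:Z) (1 + s * k%:Z))
  (fun k : nat => g (1 + s * k%:Z)) (Akk _)).
apply: eq_bigr => j _; congr (_ * _); rewrite /series_sol ifT.
  by congr trisol; case: s_unit => ->; lia.
by case: s_unit => ->; lia.
Qed.

End OrderedSeries.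

(** * Dependence on the first n coefficients, for series in z *)

Section LocalSystem.
Local Open Scope classical_set_scope.
Variable R : realType.
Implicit Types (a b f g : fseries R) (n : nat).
Implicit Type op : fseries R -> int -> int -> R[i].

Definition agree_upto (p : int) a b : Prop := forall k, k <= p -> a k = b k.

(** Without negative exponents, the coefficient at q of a product only reads coefficients of the
    factors between 0 and q. *)
Lemma agree_fmul (p : int) a a' b b' :
  starts_at 1 0 a -> starts_at 1 0 a' -> starts_at 1 0 b -> starts_at 1 0 b' ->
  agree_upto p a a' -> agree_upto p b b' ->
  agree_upto p (fmul a b) (fmul a' b').
Proof.
move=> sa sa' sb sb' ea eb q qp; apply: eq_fsbigr => k _.
have [k0|k0] := ltP k 0; first by rewrite sa ?sa' ?mul0r//; lia.
have [kq|kq] := ltP q k; first by rewrite sb ?sb' ?mulr0//; lia.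
by rewrite ea ?eb//; lia.
Qed.

Lemma agree_fexp (p : int) a a' m :
  starts_at 1 0 a -> starts_at 1 0 a' -> agree_upto p a a' ->
  agree_upto p (fexp a m) (fexp a' m).
Proof.
move=> sa sa' ea; elim: m => [|m IH]; first by [].
have unit1 : (1 : int) = 1 \/ (1 : int) = -1 by left.
apply: agree_fmul => //.
- by have := starts_fexp unit1 (m := m) sa; rewrite mul0r.
- by have := starts_fexp unit1 (m := m) sa'; rewrite mul0r.
Qed.

(** Beyond index [n] the default value of the list lookup is 0, so this is a polynomial with the
    prescribed first coefficients. *)
Definition tuple_series n (u : n.-tuple R[i]) : fseries R :=
  fun k => if k is Posz i.+1 then u`_i else 0.

Lemma agree_tuple_series n f :
  starts_at 1 1 f -> agree_upto n f (tuple_series (first_coefs n f)).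
Proof.
move=> sf [[|i]|i] kn /=; [by rewrite sf| |by rewrite sf].
have ilt : (i < n)%N by lia.
by rewrite -(tnth_nth 0 (first_coefs n f) (Ordinal ilt)) tnth_mktuple.
Qed.

Lemma starts_tuple_series n (u : n.-tuple R[i]) :
  starts_at 1 1 (tuple_series u).
Proof. by case=> [[|i]|i]//; lia. Qed.

(** The universal coefficient function: it solves the system of the truncated series, hence sees the
    two tuples only. *)
Definition coef_sol op n (u v : n.-tuple R[i]) : R[i] :=
  series_sol 1 (op (tuple_series u)) (tuple_series v) n.

(** Index [k] of the triangular system stands for exponent [k.+1]. If its entries there only read
    coefficients up to [k.+1], then truncating at [n] leaves the first [n] unknowns unchanged. *)
Lemma coef_solE op n f g :
  (forall f' f'' (j k : nat), starts_at 1 1 f' -> starts_at 1 1 f'' ->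
     (j <= k)%N -> agree_upto k.+1 f' f'' ->
     op f' j.+1 k.+1 = op f'' j.+1 k.+1) ->
  starts_at 1 1 f -> starts_at 1 1 g -> (0 < n)%N ->
  series_sol 1 (op f) g n =
  coef_sol op (first_coefs n f) (first_coefs n g).
Proof.
move=> op_local sf sg; case: n => // n _; rewrite /coef_sol /series_sol.
have -> : `|n.+1%:Z - 1|%N = n by lia.
have -> : 0 <= 1 * (n.+1%:Z - 1) by lia.
apply: eq_trisol => [j k /andP[jk kn]|k kn].
  have S1 (i : nat) : 1 + 1 * i%:Z = i.+1 by lia.
  rewrite !S1; apply: op_local => //; first exact: starts_tuple_series.
  move=> i ik; apply: agree_tuple_series => //; lia.
by apply: agree_tuple_series => //; lia.
Qed.

Lemma fderiv_local f f' (j k : nat) : (j <= k)%N -> agree_upto k.+1 f f' ->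
  fderiv f (k.+1%:Z - j.+1%:Z) = fderiv f' (k.+1%:Z - j.+1%:Z).
Proof. by move=> jk ef; rewrite /fderiv ef//; lia. Qed.

(** The exponent [j] is a natural number, so no inverse series enters and [agree_fexp] applies. *)
Lemma fexpz_local f f' (j k : nat) : starts_at 1 1 f -> starts_at 1 1 f' ->
  agree_upto k f f' -> fexpz f j k = fexpz f' j k.
Proof.
have s10 a : starts_at 1 1 a -> starts_at 1 0 a by move=> sa i i0; apply: sa; lia.
by move=> sf sf' ef; apply: (@agree_fexp k) => //; exact: s10.
Qed.

End LocalSystem.

(** * The time derivative and the two equations *)

Section FlowEquations.
Variable R : realType.
Implicit Types (f g h : fseries R).

Lemma starts_fdt (s d : int) (a b : \bar R) (f : R -> fseries R) :
  (forall t, in_oo a b t -> starts_at s d (f t)) ->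
  forall t, in_oo a b t -> starts_at s d (fdt f t).
Proof.
move=> sf t tab n sn; rewrite /fdt /cderive1.
(* The interval is open, so the coefficient vanishes on a neighbourhood of [t], and so does its
   derivative at [t]. *)
have f0 : \forall u \near t, f u n = 0.
  have /andP[at_ tb] := tab.
  near=> u; apply: sf sn; apply/andP; split; near: u.
    by move: (@open_ereal_gt R a); rewrite openE; exact.
  by move: (@open_ereal_lt R b); rewrite openE; exact.
have d0 (g : R -> R) : (\forall u \near t, g u = 0) -> derive1 g t = 0.
  by move=> g0; rewrite derive1E (near_eq_derive (g := cst 0))// derive_cst.
by rewrite !d0//; apply: filterS f0 => u ->.
Unshelve. all: by end_near. Qed.

Definition mul_system f (k n : int) : R[i] := fderiv f (n - k).

(** The derivative of f starts at exponent 0 with coefficient [f 1]; shifted by k it gives row k of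
    a triangular system with diagonal [f 1]. *)
Lemma fmul_solution (s : int) f g : s = 1 \/ s = -1 ->
  starts_at s 1 f -> f 1 != 0 -> starts_at s 1 g ->
  g = fmul (series_sol s (mul_system f) g) (fderiv f).
Proof.
move=> s_unit sf f1 sg; apply: (series_solP s_unit) => // k; last first.
  by rewrite /mul_system subrr /fderiv !add0r mul1r.
move=> n nk; rewrite /mul_system (starts_fderiv s_unit sf)//.
by rewrite mulrBr mulr0 subr_lt0.
Qed.

Lemma fcomp_solution (s : int) f g : s = 1 \/ s = -1 ->
  starts_at s 1 f -> f 1 != 0 -> starts_at s 1 g ->
  g = fcomp (series_sol s (fexpz f) g) f.
Proof.
move=> s_unit sf f1 sg; apply: (series_solP s_unit) => // k.
  exact: starts_fexpz.
exact: (fexpz_start_neq0 s_unit).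
Qed.

Lemma Cge1E f : Cge1 f <-> starts_at 1 1 f.
Proof. by split=> sf n n1; apply: sf; lia. Qed.

Lemma Cle1E f : Cle1 f <-> starts_at (-1) 1 f.
Proof. by split=> sf n n1; apply: sf; lia. Qed.

End FlowEquations.

Theorem proposition2p13 (R : realType) :
  [/\ (* series in z, (1) *)
      exists H : forall n : nat, n.-tuple R[i] -> n.-tuple R[i] -> R[i],
      forall (a b : \bar R) (f : R -> fseries R),
        (forall t, in_oo a b t -> C1z (f t)) ->
        (forall t, in_oo a b t ->
           forall n : int, cderivable (fun s => f s n) t) ->
        exists h : R -> fseries R, forall t, in_oo a b t ->
          [/\ Cge1 (h t),
              fdt f t = fmul (h t) (fderiv (f t))
            & forall n : nat, (1 <= n)%N ->
                h t n%:Z = H n (first_coefs n (f t)) (first_coefs n (fdt f t))],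
      (* series in z, (2) *)
      exists H : forall n : nat, n.-tuple R[i] -> n.-tuple R[i] -> R[i],
      forall (a b : \bar R) (f : R -> fseries R),
        (forall t, in_oo a b t -> C1z (f t)) ->
        (forall t, in_oo a b t ->
           forall n : int, cderivable (fun s => f s n) t) ->
        exists h : R -> fseries R, forall t, in_oo a b t ->
          [/\ Cge1 (h t),
              fdt f t = fcomp (h t) (f t)
            & forall n : nat, (1 <= n)%N ->
                h t n%:Z = H n (first_coefs n (f t)) (first_coefs n (fdt f t))]
    & (* series in 1/z *)
      forall (a b : \bar R) (f : R -> fseries R),
        (forall t, in_oo a b t -> C1zinv (f t)) ->
        (forall t, in_oo a b t ->
           forall n : int, cderivable (fun s => f s n) t) ->
        (exists h : R -> fseries R, forall t, in_oo a b t ->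
           Cle1 (h t) /\ fdt f t = fmul (h t) (fderiv (f t))) /\
        (exists h : R -> fseries R, forall t, in_oo a b t ->
           Cle1 (h t) /\ fdt f t = fcomp (h t) (f t))].
Proof.
have up : (1 : int) = 1 \/ (1 : int) = -1 by left.
have down : (-1 : int) = 1 \/ (-1 : int) = -1 by right.
split.
(* The coefficient functions are fixed before the interval, the family and the time are
   introduced. *)
- exists (coef_sol (@mul_system R)) => a b f fC _.
  have sf t : in_oo a b t -> starts_at 1 1 (f t) by move=> /fC[/Cge1E].
  exists (fun t => series_sol 1 (mul_system (f t)) (fdt f t)) => t tab.
  have sg := starts_fdt sf tab.
  split; first by apply/Cge1E; exact: starts_series_sol.
    by apply: fmul_solution => //; [exact: sf | case: (fC t tab)].
  move=> n n1; apply: coef_solE => //; last exact: sf.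
  by move=> f' f'' j k _ _; exact: fderiv_local.
- exists (coef_sol (@fexpz R)) => a b f fC _.
  have sf t : in_oo a b t -> starts_at 1 1 (f t) by move=> /fC[/Cge1E].
  exists (fun t => series_sol 1 (fexpz (f t)) (fdt f t)) => t tab.
  have sg := starts_fdt sf tab.
  split; first by apply/Cge1E; exact: starts_series_sol.
    by apply: fcomp_solution => //; [exact: sf | case: (fC t tab)].
  move=> n n1; apply: coef_solE => //; last exact: sf.
  by move=> f' f'' j k sf' sf'' _; exact: fexpz_local.
- move=> a b f fC _.
  have sf t : in_oo a b t -> starts_at (-1) 1 (f t) by move=> /fC[/Cle1E].
  split.
    exists (fun t => series_sol (-1) (mul_system (f t)) (fdt f t)) => t tab.
    split; first by apply/Cle1E; exact: starts_series_sol.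
    have sg := starts_fdt sf tab.
    by apply: fmul_solution => //; [exact: sf | case: (fC t tab)].
  exists (fun t => series_sol (-1) (fexpz (f t)) (fdt f t)) => t tab.
  split; first by apply/Cle1E; exact: starts_series_sol.
  have sg := starts_fdt sf tab.
  by apply: fcomp_solution => //; [exact: sf | case: (fC t tab)].
Qed.
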